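(* Let $\mathbf{L}=\langle L,\wedge,\vee,\otimes,\rightarrow,0,1\rangle$ be a complete residuated lattice. For any ranked data tables $\mathcal{D}_1$, $\mathcal{D}'_1$, $\mathcal{D}_2$, $\mathcal{D}'_2$ on a relation scheme $T$, any $a\in L$, and for $\lozenge$ being either of the operations $\cap$ and $\cup$, \begin{align*} E(\mathcal{D}_1,\mathcal{D}'_1)\wedge E(\mathcal{D}_2,\mathcal{D}'_2)&\leq E(\mathcal{D}_1\mathop{\lozenge}\mathcal{D}_2,\mathcal{D}'_1\mathop{\lozenge}\mathcal{D}'_2),\\ E(\mathcal{D}_1,\mathcal{D}'_1)\otimes E(\mathcal{D}_2,\mathcal{D}'_2)&\leq E(\mathcal{D}_1\otimes\mathcal{D}_2,\mathcal{D}'_1\otimes\mathcal{D}'_2),\\ E(\mathcal{D}_1,\mathcal{D}_2)&\leq E(a\rightarrow\mathcal{D}_1,a\rightarrow\mathcal{D}_2). \end{align*}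
   Context: A complete residuated lattice $\mathbf{L}=\langle L,\wedge,\vee,\otimes,\rightarrow,0,1\rangle$ is a complete lattice with least element $0$ and greatest element $1$ such that $\langle L,\otimes,1\rangle$ is a commutative monoid and, for all $a,b,c\in L$, $a\otimes b\leq c$ if and only if $a\leq b\rightarrow c$. The biresiduum is $a\leftrightarrow b=(a\rightarrow b)\wedge(b\rightarrow a)$. $Y$ is a set of attributes; a relation scheme is any subset $T\subseteq Y$. Each $y\in Y$ has a domain $D_y$ (a set) equipped with a similarity $\approx_y\colon D_y\times D_y\to L$, i.e., $u\approx_y u=1$ and $u\approx_y v=v\approx_y u$ for all $u,v\in D_y$. Put $\mathrm{Tupl}(T)=\prod_{y\in T}D_y$; its elements $t$ (maps with $t(y)\in D_y$ for $y\in T$) are tuples over $T$. A ranked data table (RDT) on $T$ is a (finite) $\mathbf{L}$-set in $\mathrm{Tupl}(T)$, i.e., a map $\mathcal{D}\colon\mathrm{Tupl}(T)\to L$ (finite meaning that only finitely many tuples have nonzero value). Operations, for each $t\in\mathrm{Tupl}(T)$: $(\mathcal{D}_1\cup\mathcal{D}_2)(t)=\mathcal{D}_1(t)\vee\mathcal{D}_2(t)$; $(\mathcal{D}_1\cap\mathcal{D}_2)(t)=\mathcal{D}_1(t)\wedge\mathcal{D}_2(t)$; $(\mathcal{D}_1\otimes\mathcal{D}_2)(t)=\mathcal{D}_1(t)\otimes\mathcal{D}_2(t)$; and the $a$-shift $(a\rightarrow\mathcal{D})(t)=a\rightarrow\mathcal{D}(t)$ for $a\in L$ (its result is a map $\mathrm{Tupl}(T)\to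 L$ that need not be finite). For maps $\mathcal{D}_1,\mathcal{D}_2\colon\mathrm{Tupl}(T)\to L$, the similarity degree is $E(\mathcal{D}_1,\mathcal{D}_2)=\bigwedge_{t\in\mathrm{Tupl}(T)}\bigl(\mathcal{D}_1(t)\leftrightarrow\mathcal{D}_2(t)\bigr)\in L$. *)

(* Defs.v *)
From HB Require Import structures.
From mathcomp Require Import all_boot all_order.
From mathcomp Require Import boolp classical_sets cardinality.

Set Implicit Arguments.
Unset Strict Implicit.
Unset Printing Implicit Defensive.

Import Order.TTheory.

Local Open Scope classical_set_scope.
Local Open Scope order_scope.

Declare Scope resid_scope.
Delimit Scope resid_scope with resid.

HB.mixin Record TBLattice_isComplete d L of Order.TBLattice d L := {
  supremums_neq0 : forall A : set L, supremums A !=set0;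
  infimums_neq0 : forall A : set L, infimums A !=set0
}.

#[short(type="completeLatticeType")]
HB.structure Definition CompleteLattice d :=
  { L of Order.TBLattice d L & TBLattice_isComplete d L }.

(* The unit of the monoid is the top element of the lattice; it is not assumed
   to differ from the bottom element. *)
HB.mixin Record CompleteLattice_isResiduated d L of CompleteLattice d L := {
  otimes : L -> L -> L;
  resid : L -> L -> L;
  otimesA : associative otimes;
  otimesC : commutative otimes;
  otimes1x : left_id (\top : L) otimes;
  otimes_resid : forall a b c : L, (otimes a b <= c) = (a <= resid b c)
}.

#[short(type="completeResiduatedLatticeType")]
HB.structure Definition CompleteResiduatedLattice d :=
  { L of CompleteLattice d L & CompleteLattice_isResiduated d L }.

Definition biresid d (L : completeResiduatedLatticeType d) (a b : L) : L :=
  resid a b `&` resid b a.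

Notation "a ⊗ b" := (otimes a b) (at level 40, left associativity) : resid_scope.
Notation "a ⇒ b" := (resid a b) (at level 55, right associativity) : resid_scope.
Notation "a ⇔ b" := (biresid a b) (at level 56, no associativity) : resid_scope.

Local Open Scope resid_scope.

Record simDomain d (L : completeResiduatedLatticeType d) := SimDomain {
  dom_sort :> Type;
  dom_sim : dom_sort -> dom_sort -> L;
  dom_sim_refl : forall u, dom_sim u u = \top;
  dom_sim_sym : forall u v, dom_sim u v = dom_sim v u
}.

Section RankedDataTables.
Context d (L : completeResiduatedLatticeType d) (Y : Type) (D : Y -> simDomain L).
Implicit Types T : set Y.

(* T is coerced to the subtype {y | y \in T}. *)
Definition Tupl T : Type := forall y : T, D (val y).

Definition lset T : Type := Tupl T -> L.

Record rdt T := RDT {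
  rank :> lset T;
  rank_finite : finite_set [set t | rank t != \bot]
}.

(* The operations are defined for all L-sets: a shift of an RDT need not be
   finite. *)
Definition rcup T (D1 D2 : lset T) : lset T := fun t => D1 t `|` D2 t.
Definition rcap T (D1 D2 : lset T) : lset T := fun t => D1 t `&` D2 t.
Definition rtimes T (D1 D2 : lset T) : lset T := fun t => D1 t ⊗ D2 t.
Definition rshift T (a : L) (D1 : lset T) : lset T := fun t => a ⇒ D1 t.

(* The first argument of [infimum] is its value on the empty set: with \top this
   is the true meet even if Tupl T is empty. *)
Definition simdeg T (D1 D2 : lset T) : L :=
  infimum \top (range (fun t : Tupl T => D1 t ⇔ D2 t)).

End RankedDataTables.

Notation "D1 ∪ D2" := (rcup D1 D2) (at level 50, left associativity) : resid_scope.
Notation "D1 ∩ D2" := (rcap D1 D2) (at level 48, left associativity) : resid_scope.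
Notation "D1 ⊠ D2" := (rtimes D1 D2) (at level 40, left associativity) : resid_scope.
Notation "a ⇛ D1" := (rshift a D1) (at level 55, right associativity) : resid_scope.
Notation "'E( D1 , D2 )" := (simdeg D1 D2) (format "''E(' D1 ,  D2 )") : resid_scope.

(* Main.v *)
Require Import Defs.
From mathcomp Require Import all_boot all_order.
From mathcomp Require Import boolp classical_sets cardinality.

Import Order.TTheory.

Local Open Scope order_scope.
Local Open Scope resid_scope.

Section Residuum.
Context {d : Order.disp_t} {L : completeResiduatedLatticeType d}.
Implicit Types a b c : L.

(** The degree ['E(A, B)] is a greatest lower bound of the pointwise biresidua, so each inequality
    reduces to a fixed tuple: bound every ['E] on the left by its value there ([simdeg_le]), and use
    that the connective respects [⇔] in [L], then collect over all tuples ([le_simdeg]). The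
    pointwise facts [biresid_meet], [biresid_join], [biresid_otimes] and [biresid_resid] are pairs
    of one-sided statements about [⇒], each obtained from adjointness, monotonicity of [⊗] and modus
    ponens [resid_otimes_le]. *)

Lemma otimes_le2l c a b : a <= b -> c ⊗ a <= c ⊗ b.
Proof.
move=> ab; rewrite otimesC otimes_resid (le_trans ab)//.
by rewrite -otimes_resid otimesC.
Qed.

Lemma otimes_le2r c a b : a <= b -> a ⊗ c <= b ⊗ c.
Proof. by rewrite !(otimesC _ c); exact: otimes_le2l. Qed.

Lemma otimes_le2 a b a' b' : a <= a' -> b <= b' -> a ⊗ b <= a' ⊗ b'.
Proof.
by move=> aa' bb'; rewrite (le_trans (otimes_le2l _ _ _ bb')) ?otimes_le2r.
Qed.

Lemma resid_otimes_le a b : (a ⇒ b) ⊗ a <= b.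
Proof. by rewrite otimes_resid. Qed.

Lemma resid_meet a a' b b' :
  (a ⇒ a') `&` (b ⇒ b') <= (a `&` b) ⇒ (a' `&` b').
Proof.
rewrite -otimes_resid lexI; apply/andP; split.
  by apply: le_trans (resid_otimes_le a a'); apply: otimes_le2; exact: leIl.
by apply: le_trans (resid_otimes_le b b'); apply: otimes_le2; exact: leIr.
Qed.

(** Adjointness turns multiplication by a fixed element into a left adjoint, which lets the join on
    the left be treated one summand at a time; each summand is then modus ponens. *)
Lemma resid_join a a' b b' :
  (a ⇒ a') `&` (b ⇒ b') <= (a `|` b) ⇒ (a' `|` b').
Proof.
rewrite -otimes_resid otimesC otimes_resid leUx -!otimes_resid.
rewrite !(otimesC _ (_ `&` _)).
apply/andP; split.
  apply: le_trans (leUl a' b'); apply: le_trans (resid_otimes_le a a').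
  by apply: otimes_le2r; exact: leIl.
apply: le_trans (leUr b' a'); apply: le_trans (resid_otimes_le b b').
by apply: otimes_le2r; exact: leIr.
Qed.

(** After adjunction the four factors regroup into two independent instances of modus ponens. *)
Lemma resid_otimes a a' b b' : (a ⇒ a') ⊗ (b ⇒ b') <= a ⊗ b ⇒ a' ⊗ b'.
Proof.
rewrite -otimes_resid.
have -> : (a ⇒ a') ⊗ (b ⇒ b') ⊗ (a ⊗ b) = ((a ⇒ a') ⊗ a) ⊗ ((b ⇒ b') ⊗ b).
  by rewrite -!otimesA; congr (_ ⊗ _); rewrite !otimesA (otimesC a).
by apply: otimes_le2; exact: resid_otimes_le.
Qed.

(** Transitivity of the residuum in curried form: adjunction applied twice leaves a chain of two
    modus ponens. *)
Lemma resid_trans a b c : b ⇒ c <= (a ⇒ b) ⇒ (a ⇒ c).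
Proof.
rewrite -!otimes_resid -otimesA; apply: le_trans (resid_otimes_le b c).
by apply: otimes_le2l; exact: resid_otimes_le.
Qed.

Lemma biresid_meet a a' b b' :
  (a ⇔ a') `&` (b ⇔ b') <= (a `&` b) ⇔ (a' `&` b').
Proof.
rewrite lexI; apply/andP; split; apply: le_trans (resid_meet _ _ _ _);
  by apply: leI2; rewrite ?leIl ?leIr.
Qed.

Lemma biresid_join a a' b b' :
  (a ⇔ a') `&` (b ⇔ b') <= (a `|` b) ⇔ (a' `|` b').
Proof.
rewrite lexI; apply/andP; split; apply: le_trans (resid_join _ _ _ _);
  by apply: leI2; rewrite ?leIl ?leIr.
Qed.

Lemma biresid_otimes a a' b b' : (a ⇔ a') ⊗ (b ⇔ b') <= (a ⊗ b) ⇔ (a' ⊗ b').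
Proof.
rewrite lexI; apply/andP; split; apply: le_trans (resid_otimes _ _ _ _);
  by apply: otimes_le2; rewrite ?leIl ?leIr.
Qed.

Lemma biresid_resid a b c : b ⇔ c <= (a ⇒ b) ⇔ (a ⇒ c).
Proof. by apply: leI2; exact: resid_trans. Qed.

End Residuum.

Section SimilarityDegree.
Context {d : Order.disp_t} {L : completeResiduatedLatticeType d}.
Context {Y : Type} {D : Y -> simDomain L} {T : set Y}.
Implicit Types A B : lset D T.

Lemma simdeg_le A B t : 'E(A, B) <= A t ⇔ B t.
Proof.
rewrite /simdeg /infimum; case: ifPn => [/eqP E0|_].
  (* The empty-range branch of [infimum] is impossible, since [t] contributes a value. *)
  suff: set0 (A t ⇔ B t) by [].
  by rewrite -E0; exists t.
case: xgetP => [x _ [lbx _]|noinf]; first by apply: lbx; exists t.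
(* Completeness of [L] excludes the branch where [infimum] falls back to its default. *)
have [x infx] := infimums_neq0 (range (fun t => A t ⇔ B t)).
by case: (noinf x).
Qed.

Lemma le_simdeg c A B : (forall t, c <= A t ⇔ B t) -> c <= 'E(A, B).
Proof.
(* Both default branches return [\top], which is above any [c]; this covers an empty [Tupl T]. *)
move=> cAB; rewrite /simdeg /infimum; case: ifPn => [_|_]; first exact: lex1.
case: xgetP => [x _ [_]|_]; last exact: lex1.
by apply=> _ [t _ <-]; exact: cAB.
Qed.

End SimilarityDegree.

Theorem corollary1 (d : Order.disp_t) (L : completeResiduatedLatticeType d)
    (Y : Type) (D : Y -> simDomain L) (T : set Y)
    (D1 D1' D2 D2' : rdt D T) (a : L) :
  [/\ 'E(D1, D1') `&` 'E(D2, D2') <= 'E(D1 ∩ D2, D1' ∩ D2'),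
      'E(D1, D1') `&` 'E(D2, D2') <= 'E(D1 ∪ D2, D1' ∪ D2'),
      'E(D1, D1') ⊗ 'E(D2, D2') <= 'E(D1 ⊠ D2, D1' ⊠ D2')
    & 'E(D1, D2) <= 'E(a ⇛ D1, a ⇛ D2)].
Proof.
split; apply: le_simdeg => t.
- by apply: le_trans (biresid_meet _ _ _ _); apply: leI2; exact: simdeg_le.
- by apply: le_trans (biresid_join _ _ _ _); apply: leI2; exact: simdeg_le.
- by apply: le_trans (biresid_otimes _ _ _ _); apply: otimes_le2; exact: simdeg_le.
- by apply: le_trans (biresid_resid _ _ _); exact: simdeg_le.
Qed.
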